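(* Let $n\ge 1$. Let $\alpha\in C_n$ be defined by $x\alpha=\max(1,x-1)$ for all $x\in X_n$, and let $\alpha''\in T_n$ be given by $1\alpha''=1$ and $x\alpha''=\min(x+1,n)$ for all $x\in X_n$ with $x>1$. Then $$\mathrm{Dom}_{T_n}(C_n)=\langle C_n\cup\{\alpha''\}\rangle .$$
   Context: $X_n=\{1,2,\dots,n\}$ is the finite chain with its usual order, and $T_n$ is the full transformation semigroup of all maps $X_n\to X_n$. Maps are written on the right and composed left to right: $x(\alpha\beta)=(x\alpha)\beta$. The Catalan monoid $C_n$ is the subsemigroup of $T_n$ of all maps $\alpha$ that are both order-decreasing ($x\alpha\le x$ for all $x\in X_n$) and order-preserving ($x\le y\Rightarrow x\alpha\le y\alpha$ for all $x,y\in X_n$). For a subset $A\subseteq T_n$, $\langle A\rangle$ denotes the subsemigroup of $T_n$ generated by $A$. For a subsemigroup $U$ of a semigroup $S$, an element $d\in S$ is dominated by $U$ if for every semigroup $T$ and all semigroup homomorphisms $f,g:S\to T$ with $f|_U=g|_U$ one has $(d)f=(d)g$; the dominion $\mathrm{Dom}_S(U)$ is the set of all elements of $S$ dominated by $U$ (a subsemigroup of $S$ containing $U$). *)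

(* Defs.v *)
From HB Require Import structures.
From mathcomp Require Import all_boot.
From mathcomp Require Import classical_sets.

Set Implicit Arguments.
Unset Strict Implicit.
Unset Printing Implicit Defensive.

Local Open Scope classical_set_scope.

(* The ordinal of value i stands for the point i + 1 of X_n = {1, ..., n}. *)
Definition label (n : nat) (x : 'I_n) : nat := x.+1.

(* The name T_n hides the pointwise product that the library puts on {ffun _}
   for a codomain with a product; the product of T_n is composition. *)
Definition full_transf (n : nat) : Type := {ffun 'I_n -> 'I_n}.

HB.instance Definition _ n := Choice.on (full_transf n).

Section FullTransf.
Variable n : nat.

(* Maps act on the right: x (a b) = (x a) b. *)
Definition transf_mul (a b : full_transf n) : full_transf n :=
  [ffun x => b (a x)].

Fact transf_mulA : associative transf_mul.
Proof. by move=> a b c; apply/ffunP => x; rewrite !ffunE. Qed.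

HB.instance Definition _ := isSemigroup.Build (full_transf n) transf_mulA.

End FullTransf.

Definition order_decreasing (n : nat) (a : full_transf n) : Prop :=
  forall x : 'I_n, label (a x) <= label x.

Definition order_preserving (n : nat) (a : full_transf n) : Prop :=
  forall x y : 'I_n, label x <= label y -> label (a x) <= label (a y).

Definition catalan (n : nat) : set (full_transf n) :=
  [set a | order_decreasing a /\ order_preserving a].
Arguments catalan : clear implicits.

Definition subsemigroup (S : semigroupType) (U : set S) : Prop :=
  forall u v : S, U u -> U v -> U (u * v)%g.

Definition generated (S : semigroupType) (A : set S) : set S :=
  smallest (@subsemigroup S) A.

(* The target ranges over associative magmas rather than over semigroupType
   because the latter carries a choice structure, which would exclude
   semigroups on types without one. *)
Definition dominated (S : semigroupType) (U : set S) (d : S) : Prop :=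
  forall T : magmaType, associative (@mul T) ->
  forall f g : {multiplicative S -> T},
    (forall u : S, U u -> f u = g u) -> f d = g d.

Definition dominion (S : semigroupType) (U : set S) : set S :=
  [set d | dominated U d].

Fact catalan_subsemigroup n : subsemigroup (catalan n).
Proof.
move=> u v [ud uo] [vd vo]; split=> [x | x y xy]; rewrite !ffunE.
  exact: leq_trans (vd _) (ud _).
exact/vo/uo.
Qed.

(* Main.v *)
(* For n > 2, alpha'' = alpha'' alpha alpha'' with alpha alpha'' and
   alpha'' alpha in C_n, so a zigzag puts alpha'' in the dominion; for n <= 2 it
   is the identity.  Conversely, an element dominated by U commutes with every
   map between two S-sets that commutes with the action of U.  The map
   min : X_n x X_n -> X_n and the map from a point to 1 commute with C_n, so a
   dominated transformation d preserves the order and fixes 1.  Such a d, of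
   rank r, factors as c alpha''^(n - r) e with c and e in C_n: c sends the kernel
   classes of d to 1, ..., r, the power of alpha'' moves 2, ..., r as high as
   possible, and e lowers the result to the image of d. *)

Require Import Defs.
From HB Require Import structures.
From mathcomp Require Import all_boot.
From mathcomp Require Import boolp classical_sets.
From mathcomp Require Import zify.

Local Open Scope classical_set_scope.

(** * Dominions and zigzags *)

Section Dominion.
Variables (S : semigroupType) (U : set S).

Lemma sub_dominion : U `<=` dominion U.
Proof. by move=> u Uu T mA f g; apply. Qed.

Lemma dominion_subsemigroup : subsemigroup (dominion U).
Proof.
by move=> u v du dv T mA f g fg; rewrite !gmulfM (du T mA f g) ?(dv T mA f g).
Qed.

(** The zigzag is [f y = f y * g (x * y) = f y * f x * g y = g (y * x) * g y = g y]. *)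
Lemma dominated_inverse (x y : S) : U x -> U (x * y)%g -> U (y * x)%g ->
  (y * x * y)%g = y -> dominated U y.
Proof.
move=> Ux Uxy Uyx yxy T mA f g fg.
have -> : f y = mul (f y) (mul (g x) (g y)).
  by rewrite -gmulfM -(fg _ Uxy) -gmulfM mulgA yxy.
by rewrite -(fg _ Ux) mA -gmulfM (fg _ Uyx) -gmulfM yxy.
Qed.

End Dominion.

(** * Equivariant maps as a test for dominated elements *)

Definition self_map (W : Type) : Type := W -> W.

HB.instance Definition _ (W : Type) :=
  hasMul.Build (self_map W) (fun f g : W -> W => f \o g).

Section Equivariance.
Variables (S : semigroupType) (Y Z : Type).
Variables (aY : S -> Y -> Y) (aZ : S -> Z -> Z) (h : Y -> Z).
Hypothesis aYM : forall s t y, aY (s * t)%g y = aY t (aY s y).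
Hypothesis aZM : forall s t z, aZ (s * t)%g z = aZ t (aZ s z).

Let W : Type := ((Z -> bool) * (Y -> bool))%type.

(** Precomposition turns right actions into left ones, hence a homomorphism into self-maps under
    composition. *)
Definition pull_back (s : S) : self_map W :=
  fun w => (w.1 \o aZ s, w.2 \o aY s).

(* Commutes with the action of s as soon as h does. *)
Definition twist (w : W) : W := (w.1, fun y => w.2 y (+) w.1 (h y)).

Definition twisted_pull_back (s : S) : self_map W :=
  fun w => twist (pull_back s (twist w)).

Lemma pull_backM : {morph pull_back : s t / (s * t)%g}.
Proof.
move=> s t; apply/funext => -[p q]; congr pair; apply/funext => ? /=.
  by rewrite aZM.
by rewrite aYM.
Qed.

Lemma twistK : involutive twist.
Proof. by move=> [p q]; congr pair; apply/funext => y /=; rewrite addbK. Qed.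

Lemma twisted_pull_backM : {morph twisted_pull_back : s t / (s * t)%g}.
Proof.
move=> s t; apply/funext => w.
rewrite /twisted_pull_back pull_backM.
by congr (twist (pull_back s _)); rewrite twistK.
Qed.

HB.instance Definition _ :=
  isMultiplicative.Build S (self_map W) pull_back pull_backM.
HB.instance Definition _ :=
  isMultiplicative.Build S (self_map W) twisted_pull_back twisted_pull_backM.

(** Conjugation by the involution [twist] gives a second homomorphism, which agrees with [pull_back]
    wherever [h] is equivariant: on [U], hence at [d]. *)
Lemma dominated_equivariant (U : set S) (d : S) :
  (forall u, U u -> forall y, h (aY u y) = aZ u (h y)) ->
  dominated U d -> forall y, h (aY d y) = aZ d (h y).
Proof.
move=> hU domd y.
have mA : associative (@mul (self_map W)) by [].
have fg u : U u -> pull_back u = twisted_pull_back u.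
  move=> Uu; apply/funext => -[p q]; congr pair; apply/funext => z /=.
  by rewrite hU // addbK.
(* On the indicator of [h (aY d y)] paired with the zero function, the two values at [y] differ
   unless [aZ d (h y)] is that same point. *)
have /(congr1 (fun k : W -> W =>
    (k (fun z => `[< z = h (aY d y) >], fun=> false)).2 y)) /= :=
  domd (self_map W) mA pull_back twisted_pull_back fg.
by rewrite asboolT // => /esym /asboolP ->.
Qed.

End Equivariance.

(** * Invariants of the transformations dominated by [catalan n] *)

Lemma dominated_catalan_mono (n : nat) (d : full_transf n) :
  dominated (catalan n) d -> order_preserving d.
Proof.
pose aY (s : full_transf n) (y : 'I_n * 'I_n) := (s y.1, s y.2).
pose aZ (s : full_transf n) (z : 'I_n) := s z.
pose h (y : 'I_n * 'I_n) := if y.1 <= y.2 then y.1 else y.2.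
move=> domd x y le_xy.
have aYM s t z : aY (s * t)%g z = aY t (aY s z) by rewrite /aY /= !ffunE.
have aZM s t z : aZ (s * t)%g z = aZ t (aZ s z) by rewrite /aZ ffunE.
have hU u : catalan n u -> forall y, h (aY u y) = aZ u (h y).
  move=> [_ uo] [a b]; rewrite /h /aY /aZ /=.
  case: (leqP a b) => [le_ab|/ltnW le_ba]; first by rewrite ifT //; apply: uo.
  by case: leqP => // uab; apply/val_inj/eqP; rewrite eqn_leq uab; apply: uo.
have := dominated_equivariant _ _ _ _ _ h aYM aZM _ _ hU domd (x, y).
have le_xy' : x <= y := le_xy.
rewrite /h /aY /aZ /= le_xy'.
by case: (leqP (d x) (d y)) => [//|_ dyx]; rewrite dyx.
Qed.

Lemma dominated_catalan_fix (n : nat) (d : full_transf n) (x : 'I_n) :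
  dominated (catalan n) d -> label x = 1 -> d x = x.
Proof.
pose aY (s : full_transf n) (y : unit) := y.
pose aZ (s : full_transf n) (z : 'I_n) := s z.
move=> domd x1; apply/esym.
apply: (@dominated_equivariant _ _ _ aY aZ (fun=> x) _ _ _ _ _ domd tt) => //.
  by move=> s t z; rewrite /aZ /= ffunE.
move=> u [ud _] _; apply/val_inj; move: (ud x) x1; rewrite /aZ /label /=; lia.
Qed.

(** * Factorization of an order-preserving map that fixes the point 1 *)

Lemma card_ord_lt (n m : nat) :
  m <= n -> #|[set y : 'I_n | y < m]%SET| = m.
Proof.
move=> le_mn; rewrite cardsE -sum1_card.
by rewrite -(big_ord_widen n (fun=> 1) le_mn) sum1_card card_ord.
Qed.

Section Factorization.
Variables (n : nat) (up : full_transf n).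
Hypothesis up1 : forall x, label x = 1 -> label (up x) = 1.
Hypothesis upE : forall x, 1 < label x -> label (up x) = minn (label x + 1) n.

Lemma iter_up (k : nat) (x : 'I_n) :
  iter k up x = (if x == 0 :> nat then 0 else minn (x + k) n.-1) :> nat.
Proof.
elim: k => [|k IHk] /=.
  by have := ltn_ord x; case: eqP => // ? ?; lia.
have := ltn_ord x; move: IHk; set y := iter k up x.
have [y0|y_gt0] := posnP y.
  by have := up1 y; rewrite /label y0 => /(_ erefl); case: eqP; lia.
by have := upE y; rewrite /label; case: eqP; lia.
Qed.

Lemma iter_mul_transf (k : nat) (c : full_transf n) (x : 'I_n) :
  iter k (fun s => (s * up)%g) c x = iter k up (c x).
Proof. by elim: k => //= k IHk; rewrite ffunE IHk. Qed.

Variable d : full_transf n.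
Hypothesis d_mono : order_preserving d.
Hypothesis d_fix : forall x : 'I_n, label x = 1 -> d x = x.

Let im : {set 'I_n} := [set d x | x : 'I_n]%SET.
(** The size of this set is the zero-based index of the kernel class of [x]. *)
Let below (x : 'I_n) : {set 'I_n} := [set z in im | z < d x]%SET.
Let k : nat := n - #|im|.
Let shift (i : nat) : nat := if i == 0 then 0 else i + k.

(** Since [d] preserves the order, image values below [d x] come from points below [x]. This makes
    [c] decreasing. *)
Lemma card_below_le (x : 'I_n) : #|below x| <= x.
Proof.
rewrite -[leqRHS](card_ord_lt _ _ (ltnW (ltn_ord x))).
apply: leq_trans (leq_imset_card d _); apply/subset_leq_card/fintype.subsetP => z.
rewrite inE => /andP[/imsetP[y _ ->] lt_yx]; apply: imset_f; rewrite inE.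
by rewrite ltnNge; apply: contraL lt_yx => /d_mono; rewrite -leqNgt.
Qed.

Lemma card_below_homo (x y : 'I_n) : d x <= d y -> #|below x| <= #|below y|.
Proof.
move=> le_xy; apply/subset_leq_card/fintype.subsetP => z; rewrite !inE.
by move=> /andP[-> /leq_trans]; apply.
Qed.

Lemma card_below_mono (x y : 'I_n) : d x < d y -> #|below x| < #|below y|.
Proof.
move=> lt_xy; apply/proper_card/properP; split.
  by apply/fintype.subsetP => z; rewrite !inE => /andP[-> /ltn_trans]; apply.
by exists (d x); rewrite !inE ?ltnn ?andbF // lt_xy imset_f.
Qed.

(** Image values outside [below x] lie among the [n - d x] ordinals from [d x] on. Rearranged:
    [d x <= #|below x| + k]. *)
Lemma card_above_le (x : 'I_n) : #|im| <= #|below x| + (n - d x).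
Proof.
have -> : n - d x = #|[set z : 'I_n | d x <= z]%SET|.
  have := cardsC [set z : 'I_n | z < d x]%SET.
  rewrite card_ord card_ord_lt ?(ltnW (ltn_ord _)) //.
  have -> : (~: [set z : 'I_n | z < d x] = [set z : 'I_n | d x <= z])%SET.
    by apply/finset.setP => z; rewrite !inE -leqNgt.
  by lia.
apply: leq_trans (leq_of_leqif (leq_card_setU _ _)).
apply/subset_leq_card/fintype.subsetP => z imz.
by rewrite !inE imz /=; case: ltnP.
Qed.

Let c : full_transf n :=
  [ffun x => Ordinal (leq_ltn_trans (card_below_le x) (ltn_ord x))].

(** The maximum extends the required values [d x] at [shift (c x)] monotonically to every [j]. *)
Let e_val (j : 'I_n) : nat := \max_(x | shift (c x) <= j) d x.

Lemma le_shift_card_below (x : 'I_n) : d x <= shift (c x).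
Proof.
rewrite /shift /c ffunE /=; have := card_above_le x; have := ltn_ord (d x).
have := max_card im; rewrite card_ord /k.
(* [shift] does not raise 0, so class 0 must already have value 0: no image value, in particular not
   [d x0 = 0], lies below [d x]. *)
case: eqP => [c0 _ _ _|_].
  have n_gt0 : 0 < n by apply: leq_ltn_trans (ltn_ord x).
  pose x0 := Ordinal n_gt0; have dx0 : d x0 = x0 by apply: d_fix.
  have : ~~ (d x0 < d x) by apply/negP => /card_below_mono; rewrite c0.
  by rewrite dx0 -leqNgt.
by move: #|im| #|below x| (nat_of_ord (d x)) => r b y; lia.
Qed.

Lemma e_val_le (j : 'I_n) : e_val j <= j.
Proof. by apply/bigmax_leqP => x; apply: leq_trans (le_shift_card_below x). Qed.

Let e : full_transf n :=
  [ffun j => Ordinal (leq_ltn_trans (e_val_le j) (ltn_ord j))].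

Lemma catalan_c : catalan n c.
Proof.
split=> [x|x y xy]; rewrite /label !ffunE ltnS /=; first exact: card_below_le.
exact/card_below_homo/d_mono.
Qed.

Lemma catalan_e : catalan n e.
Proof.
split=> [x|x y xy]; rewrite /label !ffunE ltnS /=; first exact: e_val_le.
apply/bigmax_leqP => z /leq_trans/(_ xy) zy.
exact: (leq_bigmax_cond (F := fun z => nat_of_ord (d z))).
Qed.

(** The value [d x] is in [im] but not in [below x], so the class index is less than [#|im|] and the
    climb by [k] stays within the cap [n.-1]. *)
Lemma iter_up_c (x : 'I_n) : iter k up (c x) = shift (c x) :> nat.
Proof.
rewrite iter_up /shift; case: eqP => // _; apply/minn_idPl.
have lt_c : #|below x| < #|im|.
  apply/proper_card/properP; split.
    by apply/fintype.subsetP => z; rewrite inE => /andP[].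
  by exists (d x); rewrite ?inE ?ltnn ?andbF // imset_f.
have := max_card im; rewrite card_ord /k /c ffunE /=.
by move: #|im| #|below x| lt_c => r b; lia.
Qed.

(** Iterating from [c] lets [k = 0] do without an identity element. *)
Lemma factorization : d = (iter k (fun s => (s * up)%g) c * e)%g.
Proof.
apply/ffunP => x; apply/val_inj.
rewrite ffunE iter_mul_transf [in RHS]ffunE /= /e_val iter_up_c.
apply/eqP; rewrite eqn_leq; apply/andP; split.
  exact: (leq_bigmax_cond (F := fun z => nat_of_ord (d z))).
(* As [shift] is strictly increasing, [d x < d y] would put [shift (c y)] above [shift (c x)]. *)
apply/bigmax_leqP => y le_yx; rewrite leqNgt; apply/negP => /card_below_mono.
by move: le_yx; rewrite /shift /c !ffunE /=; case: eqP; case: eqP; lia.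
Qed.

Lemma generated_mono_fix : generated (catalan n `|` [set up]) d.
Proof.
rewrite factorization => A [Amul subA].
have Acat s : catalan n s -> A s by move=> cs; apply: subA; left.
apply: (Amul); last exact/Acat/catalan_e.
elim: k => [|m IHm] /=; first exact/Acat/catalan_c.
by apply: Amul => //; apply: subA; right.
Qed.

End Factorization.

Theorem proposition4p2 (n : nat) (n_ge1 : 1 <= n)
  (alpha : full_transf n) (alpha_catalan : catalan n alpha)
  (alphaE : forall x : 'I_n, label (alpha x) = maxn 1 (label x - 1))
  (alpha'' : full_transf n)
  (alpha''1 : forall x : 'I_n, label x = 1 -> label (alpha'' x) = 1)
  (alpha''E : forall x : 'I_n,
     1 < label x -> label (alpha'' x) = minn (label x + 1) n) :
  dominion (catalan n) = generated (catalan n `|` [set alpha'']).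
Proof.
have up_val (x : 'I_n) :
    alpha'' x = (if x == 0 :> nat then 0 else minn x.+1 n.-1) :> nat.
  by rewrite -addn1 -(iter_up _ _ alpha''1 alpha''E 1).
have down_val (x : 'I_n) : alpha x = x.-1 :> nat.
  by have := alphaE x; rewrite /label; lia.
apply/seteqP; split=> [d domd|].
  apply: generated_mono_fix => //; first exact: dominated_catalan_mono.
  by move=> x; apply: dominated_catalan_fix.
apply: smallest_sub; first exact: dominion_subsemigroup.
rewrite subUset; split; first exact: sub_dominion.
move=> _ ->; have [n_le2|n_gt2] := leqP n 2.
  apply: sub_dominion; split=> [x|x y]; rewrite /label !up_val.
    by have := ltn_ord x; case: eqP; lia.
  by case: eqP; case: eqP; lia.
apply: (dominated_inverse _ _ alpha) => //.
(* [alpha * alpha''] sends the point 2 to 1 and fixes the rest. *)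
- split=> [x|x y]; rewrite /label !ffunE !up_val !down_val.
    by have := ltn_ord x; case: eqP; lia.
  by case: eqP; case: eqP; lia.
(* [alpha'' * alpha] sends the point [n] to [n - 1] and fixes the rest. *)
- split=> [x|x y]; rewrite /label !ffunE !down_val !up_val.
    by have := ltn_ord x; case: eqP; lia.
  by case: eqP; case: eqP; lia.
apply/ffunP => x; apply/val_inj; rewrite /= !ffunE up_val down_val up_val.
by have := ltn_ord x; case: (posnP x) => [->|x_gt0] //; case: eqP; lia.
Qed.
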